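(* Let $N\ge2$ be an integer and $K$ an oriented knot. The level $N$ universal invariant $\widetilde\Omega_N(K)(q,s)\in\widetilde L_N=L/\widetilde{\mathcal I}_N$ recovers the $N$-th coloured Jones polynomial and the $N$-th ADO (coloured Alexander) invariant: $$\widetilde\Omega_N(K)\big|_{s=q^{N-1}}=J_N(K,q),\qquad \widetilde\Omega_N(K)\big|_{q=\xi_N}=\Phi_N(K,s).$$
   Context: Let $L=\mathbb Q[q^{\pm2},s^{\pm2}]\subset A=\mathbb Q[q^{\pm1},s^{\pm1}]$, $\varphi_d$ the $d$-th cyclotomic polynomial, $\xi_N=e^{\pi i/N}$ (so $\xi_N^2$ is a root of $\varphi_N$), and $$\widetilde{\mathcal I}_N=\bigl(\varphi_N(q^2)(s^2q^{-2N+2}-1)\bigr)\cap\prod_{d\mid N,\ d\ne1,N}\Bigl(\varphi_d(q^2),\ \tfrac{s^{2d}-1}{s^2-1}\Bigr)\subseteq L$$ (empty product $=L$). $[m]_q=\frac{q^m-q^{-m}}{q-q^{-1}}$, $[m]_q!=[1]_q\cdots[m]_q$, ${m\brack j}_q=\frac{[m]_q!}{[m-j]_q!\,[j]_q!}$. On the free $A$-module with basis $v_0,v_1,\dots$ (the Verma module of $U_q(sl_2)$, with $Kv_i=sq^{-2i}v_i$) put $$R(v_i\otimes v_j)= s^{-(i+j)} \sum_{m=0}^{i} q^{2(i-m)(j+m)}q^{\frac{m(m-1)}{2}} {m+j \brack j}_q \prod_{k=0}^{m-1}(sq^{-k-j}-s^{-1}q^{k+j}) \ v_{j+m}\otimes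 v_{i-m},$$ $$R^{-1}(v_i\otimes v_j)= s^{i+j} \sum_{m=0}^{j} (-1)^{m}q^{-2ij}q^{-\frac{m(m-1)}{2}} {m+i \brack i}_q \prod_{k=0}^{m-1}(sq^{-i-k}-s^{-1}q^{k+i}) \ v_{j-m}\otimes v_{i+m}.$$ Let $U$ be the free $A$-module on $v_0,\dots,v_{N-1}$, and let $R_N^{\pm}$ be the endomorphisms of $U\otimes U$ given by the formulas for $R^{\pm1}$ keeping only the terms whose two output indices lie in $\{0,\dots,N-1\}$. For a braid word $\beta=\sigma_{i_1}^{\epsilon_1}\cdots\sigma_{i_r}^{\epsilon_r}$ on $n$ strands let $\rho_N(\beta)\in\operatorname{End}(U^{\otimes n})$ be the composite, in this order, of the $\mathrm{Id}^{\otimes(i_l-1)}\otimes R_N^{\epsilon_l}\otimes\mathrm{Id}^{\otimes(n-i_l-1)}$, and $w(\beta)=\sum_l\epsilon_l$. With $f_{v_{0,j_2,\dots,j_n}}^{v_{0,j_2,\dots,j_n}}$ the diagonal coefficient of $f\in\operatorname{End}(U^{\otimes n})$ at $v_0\otimes v_{j_2}\otimes\cdots\otimes v_{j_n}$, put $$W_N(\beta)=s^{w(\beta)(N-1)}q^{-w(\beta)N(N-1)}\; s^{-(N-1)(n-1)}q^{N(N-1)(n-1)}\sum_{j_2,\dots,j_n=0}^{N-1}q^{-2\sum_{k=2}^nj_k}\,\rho_N(\beta)_{v_{0,j_2,\dots,j_n}}^{v_{0,j_2,\dots,j_n}},$$ which lies in $L$ when the closure of $\beta$ is a knot. For a knot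 $K$ that is the closure of $\beta$, $\widetilde\Omega_N(K)(q,s)\in\widetilde L_N$ is the class of $W_N(\beta)$ (independent of $\beta$). The specialisations are those induced on $\widetilde L_N$ by the ring maps $L\to\mathbb Q[q^{\pm2}]$, $s\mapsto q^{N-1}$, and $L\to\mathbb Q(\xi_N^2)[s^{\pm2}]$, $q\mapsto\xi_N$. $J_N(K,q)\in\mathbb Q[q^{\pm2}]$ is the $N$-th coloured Jones polynomial: the framing-corrected quantum invariant, equal to $1$ on the unknot, coming from the $N$-dimensional irreducible representation of $U_q(sl_2)$ of highest weight $q^{N-1}$ at generic $q$, i.e. from the operators above on $\langle v_0,\dots,v_{N-1}\rangle$ with $s=q^{N-1}$, the same partial trace and the same writhe normalisation. $\Phi_N(K,s)\in\mathbb Q(\xi_N^2)[s^{\pm2}]$ is the $N$-th ADO invariant: the framing-corrected quantum invariant, equal to $1$ on the unknot, coming from the $N$-dimensional highest weight representation of $U_q(sl_2)$ at $q=\xi_N$ with generic highest weight $s$, i.e. from the operators above on $\langle v_0,\dots,v_{N-1}\rangle$ with $q=\xi_N$, the same partial trace and the same writhe normalisation. *)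

(* Defs.v *)
From HB Require Import structures.
From mathcomp Require Import all_boot all_order all_algebra all_fingroup.
From mathcomp Require Import fraction ring_quotient generic_quotient.
From mathcomp Require Import cyclotomic complex.
From mathcomp Require Import boolp classical_sets reals trigo.

Set Implicit Arguments.
Unset Strict Implicit.
Unset Printing Implicit Defensive.

Import GRing.Theory.
Local Open Scope ring_scope.
Local Open Scope classical_set_scope.

(* A braid word on nb.+1 strands; (i, true) is sigma_(i+1) and (i, false) its
   inverse, so i : 'I_nb ranges over the nb generators. *)
Record braid := Braid { nb : nat ; word : seq ('I_nb * bool) }.

Definition lpos n (i : 'I_n) : 'I_n.+1 := widen_ord (leqnSn n) i.
Definition rpos n (i : 'I_n) : 'I_n.+1 := lift ord0 i.

Definition writhe (b : braid) : int :=
  \sum_(g <- word b) (if g.2 then 1 else -1).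

Definition braid_perm (b : braid) : 'S_(nb b).+1 :=
  (\prod_(g <- word b) tperm (lpos g.1) (rpos g.1))%g.

(* The components of the closure are the cycles of the permutation. *)
Definition closes_to_knot (b : braid) : Prop := #|porbits (braid_perm b)| = 1%N.

Inductive markov : braid -> braid -> Prop :=
| markov_refl b : markov b b
| markov_sym b c : markov b c -> markov c b
| markov_trans b c d : markov b c -> markov c d -> markov b d
| markov_cancel n (u v : seq ('I_n * bool)) i e :
    markov (Braid (u ++ [:: (i, e); (i, ~~ e)] ++ v)) (Braid (u ++ v))
| markov_far n (u v : seq ('I_n * bool)) (i j : 'I_n) e f : (i.+1 < j)%N ->
    markov (Braid (u ++ [:: (i, e); (j, f)] ++ v))
           (Braid (u ++ [:: (j, f); (i, e)] ++ v))
| markov_braid n (u v : seq ('I_n * bool)) (i j : 'I_n) : i.+1 = j :> nat ->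
    markov (Braid (u ++ [:: (i, true); (j, true); (i, true)] ++ v))
           (Braid (u ++ [:: (j, true); (i, true); (j, true)] ++ v))
| markov_conj n (u v : seq ('I_n * bool)) :
    markov (Braid (u ++ v)) (Braid (v ++ u))
| markov_stab n (u : seq ('I_n * bool)) e :
    markov (Braid u)
           (Braid (rcons [seq (lpos g.1, g.2) | g <- u] (@ord_max n, e))).

(* By the theorems of Alexander and Markov, isotopy classes of oriented links
   are the Markov classes of braids.  [closure_of K b] says that K is the closure
   of b.  The number of components is constant on a class. *)
Record oriented_knot := OrientedKnot {
  closure_of : braid -> Prop ;
  closure_of_class : exists b, forall c, closure_of c <-> markov b c ;
  closure_of_knot : forall b, closure_of b -> closes_to_knot b }.

Section Quantum.
Variables (F : fieldType) (q s : F).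

Definition qint (m : nat) : F := (q ^+ m - q ^- m) / (q - q^-1).
Definition qfact (m : nat) : F := \prod_(1 <= k < m.+1) qint k.
Definition qbin (m j : nat) : F := qfact m / (qfact (m - j) * qfact j).

(* coefficient of v_(j+m) (x) v_(i-m) in R (v_i (x) v_j), for m <= i *)
Definition R_term (i j m : nat) : F :=
  s ^- (i + j) * (q ^+ (2 * (i - m) * (j + m)) * q ^+ (m * (m - 1))./2
    * qbin (m + j) j
    * \prod_(0 <= k < m) (s * q ^- (k + j) - s^-1 * q ^+ (k + j))).

(* coefficient of v_(j-m) (x) v_(i+m) in R^-1 (v_i (x) v_j), for m <= j *)
Definition Rinv_term (i j m : nat) : F :=
  s ^+ (i + j) * ((-1) ^+ m * q ^- (2 * i * j) * q ^- (m * (m - 1))./2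
    * qbin (m + i) i
    * \prod_(0 <= k < m) (s * q ^- (i + k) - s^-1 * q ^+ (k + i))).

(* coefficient of v_k (x) v_l in R (v_i (x) v_j) if e, in R^-1 (v_i (x) v_j)
   otherwise *)
Definition R_coef (e : bool) (i j k l : nat) : F :=
  if e then \sum_(m < i.+1 | (k == j + m)%N && (l == i - m)%N) R_term i j m
  else \sum_(m < j.+1 | (k == j - m)%N && (l == i + m)%N) Rinv_term i j m.

Variable N : nat.

(* The basis of U^(x)(n+1): a : state n stands for
   v_(a 0) (x) ... (x) v_(a n).  All indices are < N, so that using R_coef on
   them is the truncation to U. *)
Definition state (n : nat) := {ffun 'I_n.+1 -> 'I_N}.
Definition Upow (n : nat) := {ffun state n -> F}.
Definition basis n (a : state n) : Upow n := [ffun c => (c == a)%:R].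

(* Id^(x)(i-1) (x) R_N^(+-1) (x) Id^(x)(n-i-1) *)
Definition gen_op n (g : 'I_n * bool) (x : Upow n) : Upow n :=
  let: (i, e) := g in
  [ffun c : state n =>
    \sum_(a : state n
          | [forall k, (k != lpos i) && (k != rpos i) ==> (c k == a k)])
      R_coef e (a (lpos i)) (a (rpos i)) (c (lpos i)) (c (rpos i)) * x a].

(* rho (g_1 ... g_r) = gen_op g_1 o ... o gen_op g_r *)
Definition rho n (w : seq ('I_n * bool)) (x : Upow n) : Upow n :=
  foldr (@gen_op n) x w.

(* b has n.+1 strands: the sum is over v_0 (x) v_(a 1) (x) ... (x) v_(a n) and the
   normalisation is that of n strands closed up. *)
Definition W (b : braid) : F :=
  let n := nb b in
  s ^ (writhe b * (N - 1)%N%:Z) * q ^ (- (writhe b * (N * (N - 1))%N%:Z))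
  * (s ^- ((N - 1) * n) * q ^+ (N * (N - 1) * n))
  * \sum_(a : state n | a ord0 == 0%N :> nat)
      q ^- (2 * \sum_(k < n) a (lift ord0 k)) * rho (word b) (basis a) a.

End Quantum.

Section Adjoin.
Variable F : fieldType.

(* smallest subring containing the rationals and the elements of xs; the
   fields F used below have characteristic 0 *)
Definition Qadj (xs : seq F) : {pred F} := fun x =>
  `[< forall P : {pred F}, GRing.subring_closed P ->
        (forall c : rat, ratr c \in P) -> {subset xs <= P} -> x \in P >].

Variable xs : seq F.

Fact Qadj_subring_closed : GRing.subring_closed (Qadj xs).
Proof.
split.
- by apply/asboolP => P [P1 _ _].
- move=> x y /asboolP xP /asboolP yP; apply/asboolP => P Pcl PQ Pxs.
  by have [_ + _] := Pcl; apply; [apply: xP | apply: yP].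
- move=> x y /asboolP xP /asboolP yP; apply/asboolP => P Pcl PQ Pxs.
  by have [_ _ +] := Pcl; apply; [apply: xP | apply: yP].
Qed.

HB.instance Definition _ :=
  GRing.isSubringClosed.Build F (Qadj xs) Qadj_subring_closed.

Fact mem_Qadj x : x \in xs -> x \in Qadj xs.
Proof. by move=> xxs; apply/asboolP => P _ _; exact. Qed.

Record Qalg := MkQalg { Qval :> F ; QvalP : Qval \in Qadj xs }.
HB.instance Definition _ := [isSub of Qalg for Qval].
HB.instance Definition _ := [Choice of Qalg by <:].
HB.instance Definition _ := [SubChoice_isSubComNzRing of Qalg by <:].

End Adjoin.

Section Ideals.
Variable L : comNzRingType.

Definition ideal_gen (G : set L) : set L :=
  [set x | exists2 r : seq (L * L),
     (forall y, y \in r -> G y.2) & x = \sum_(y <- r) y.1 * y.2].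

Definition ideal_mul (I J : set L) : set L :=
  ideal_gen [set x * y | x in I & y in J].

Definition is_ideal (I : set L) :=
  I 0 /\ forall a u v, I u -> I v -> I (a * u + v).

Fact ideal_gen_ideal G : is_ideal (ideal_gen G).
Proof.
split; first by exists [::]; rewrite ?big_nil.
move=> a u v [r rG ->] [t tG ->]; exists ([seq (a * y.1, y.2) | y <- r] ++ t).
- move=> y; rewrite mem_cat => /orP[/mapP[z zr ->] | yt]; last exact: tG.
  exact: (rG z).
- rewrite big_cat big_map /= mulr_sumr; congr (_ + _).
  by apply: eq_bigr => y _; rewrite mulrA.
Qed.

End Ideals.

(* Q(q,s), which contains A = Q[q^+-1, s^+-1] *)
Definition Qqs := {fraction {poly {poly rat}}}.
Definition qq : Qqs := tofrac ('X%:P : {poly {poly rat}}).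
Definition ss : Qqs := tofrac ('X : {poly {poly rat}}).

(* L = Q[q^+-2, s^+-2], as a subring and as a ring *)
Definition L_pred : {pred Qqs} := Qadj [:: qq ^+ 2; qq ^- 2; ss ^+ 2; ss ^- 2].
Definition L : Type := Qalg [:: qq ^+ 2; qq ^- 2; ss ^+ 2; ss ^- 2].
HB.instance Definition _ := GRing.ComNzRing.on L.

Definition q2 : L := MkQalg (mem_Qadj (mem_head _ _)).

Fact q2V_mem : qq ^- 2 \in Qadj [:: qq ^+ 2; qq ^- 2; ss ^+ 2; ss ^- 2].
Proof. by apply: mem_Qadj; rewrite !inE eqxx !orbT. Qed.
Definition q2V : L := MkQalg q2V_mem.

Fact s2_mem : ss ^+ 2 \in Qadj [:: qq ^+ 2; qq ^- 2; ss ^+ 2; ss ^- 2].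
Proof. by apply: mem_Qadj; rewrite !inE eqxx !orbT. Qed.
Definition s2 : L := MkQalg s2_mem.

Section Ideal.
Variable N : nat.

Definition phi (d : nat) (x : L) : L := (map_poly intr ('Phi_d)).[x].

(* phi_N(q^2) (s^2 q^(-2N+2) - 1) *)
Definition gen_top : L := phi N q2 * (s2 * q2V ^+ (N - 1) - 1).

(* (phi_d(q^2), (s^(2d) - 1) / (s^2 - 1)); the quotient is the geometric sum,
   see subrX1 *)
Definition ideal_d (d : nat) : set L :=
  ideal_gen [set phi d q2; \sum_(k < d) s2 ^+ k].

Definition Itilde_set : set L :=
  ideal_gen [set gen_top] `&`
  \big[@ideal_mul L/setT]_(d <- divisors N | (d != 1%N) && (d != N)) ideal_d d.

Definition Itilde : {pred L} := fun x => `[< Itilde_set x >].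

Let qs : {poly {poly rat}} := 'X%:P * 'X.

Fact qq_neq0 : qq != 0.
Proof. by rewrite tofrac_eq0 polyC_eq0 polyX_eq0. Qed.

Fact ss_neq0 : ss != 0.
Proof. by rewrite tofrac_eq0 polyX_eq0. Qed.

Fact L_poly (x : L) :
  exists (k : nat) (p : {poly {poly rat}}), val x * tofrac qs ^+ k = tofrac p.
Proof.
have qsE : tofrac qs = qq * ss by rewrite rmorphM.
case: x => x xP /=; have /asboolP xL := xP.
pose P : {pred Qqs} := fun x => `[< exists (k : nat) (p : {poly {poly rat}}),
  x * tofrac qs ^+ k = tofrac p >].
apply/asboolP; change (x \in P).
apply: xL; first split.
- by apply/asboolP; exists 0%N, 1; rewrite mulr1 rmorph1.
- move=> u v /asboolP[k [p up]] /asboolP[l [r vr]]; apply/asboolP.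
  exists (k + l)%N, (p * qs ^+ l - r * qs ^+ k).
  rewrite rmorphB [X in _ = X - _]rmorphM [X in _ = _ - X]rmorphM.
  rewrite !(rmorphXn _ _ qs) /= -up -vr exprD mulrBl.
  by rewrite !mulrA [v * _ * _]mulrAC.
- move=> u v /asboolP[k [p up]] /asboolP[l [r vr]]; apply/asboolP.
  by exists (k + l)%N, (p * r); rewrite [RHS]rmorphM /= -up -vr exprD mulrACA.
- move=> c; apply/asboolP; exists 0%N, (c%:P%:P); rewrite mulr1.
  by rewrite -(fmorph_eq_rat (@tofrac {poly {poly rat}} \o (polyC \o polyC))).
- move=> u; rewrite !inE => /or4P[] /eqP ->; do 2!apply/asboolP.
  + by exists 0%N, ('X%:P ^+ 2); rewrite mulr1 rmorphXn.
  + exists 2%N, ('X ^+ 2); rewrite qsE rmorphXn /= exprMn mulrA.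
    by rewrite mulVf ?mul1r // expf_neq0 // qq_neq0.
  + by exists 0%N, ('X ^+ 2); rewrite mulr1 rmorphXn.
  + exists 2%N, ('X%:P ^+ 2); rewrite qsE rmorphXn /= exprMn mulrCA.
    by rewrite mulVf ?mulr1 // expf_neq0 // ss_neq0.
Qed.

(* evaluation at s = q^(N-1) kills gen_top *)
Fact gen_top_not_unit (a : L) : a * gen_top <> 1.
Proof.
have [k [p ap]] := L_poly (a * phi N q2) => a1.
set M := (N - 1)%N in a1 *.
have : tofrac (qs ^+ k * ('X%:P ^+ (2 * M))) =
       tofrac (p * ('X ^+ 2 - 'X%:P ^+ (2 * M))).
  have : val (a * gen_top) * tofrac (qs ^+ k * 'X%:P ^+ (2 * M)) =
      val a * val (phi N q2) * tofrac qs ^+ k *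
        ((ss ^+ 2 * (qq ^- 2) ^+ M - 1) * qq ^+ (2 * M)).
    have -> : val (a * gen_top) = val a * (val (phi N q2) *
      (ss ^+ 2 * (qq ^- 2) ^+ M - 1)).
      by rewrite /gen_top -/M !(rmorphM, rmorphB, rmorphXn, rmorph1).
    rewrite rmorphM !rmorphXn /= -/qq !mulrA; congr (_ * _).
    by rewrite -!mulrA; congr (_ * (_ * _)); rewrite mulrC.
  rewrite a1 mul1r => ->; rewrite (_ : val a * _ = val (a * phi N q2)) // ap.
  rewrite mulrBl mul1r -mulrA exprVn -exprM mulVf; last first.
    by rewrite expf_neq0 // qq_neq0.
  by rewrite mulr1 rmorphM rmorphB !rmorphXn.
move/eqP; rewrite tofrac_eq => /eqP/(congr1 (horner^~ ('X ^+ M))) /eqP.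
rewrite /qs !hornerE -!exprM [(M * 2)%N]mulnC subrr mulr0.
by rewrite !(mulf_eq0, expf_eq0, polyX_eq0) !andbF.
Qed.

Fact Itilde_idealr : idealr_closed Itilde.
Proof.
have big_id : is_ideal (\big[@ideal_mul L/setT]_(d <- divisors N |
    (d != 1%N) && (d != N)) ideal_d d).
  by apply: big_ind => // *; exact: ideal_gen_ideal.
have top_id := ideal_gen_ideal [set gen_top].
split.
- by apply/asboolP; split; [apply: (proj1 top_id) | apply: (proj1 big_id)].
- apply/asboolP => -[[r rG r1] _].
  apply: (@gen_top_not_unit (\sum_(y <- r) y.1)); rewrite r1 mulr_suml.
  by apply: eq_big_seq => y /rG ->.
- move=> a u v /asboolP[u1 u2] /asboolP[v1 v2]; apply/asboolP; split.
  + exact: (proj2 top_id).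
  + exact: (proj2 big_id).
Qed.

HB.instance Definition _ := isIdealr.Build L Itilde Itilde_idealr.

Definition Ltilde := {ideal_quot Itilde}.
HB.instance Definition _ := GRing.ComNzRing.on Ltilde.

Definition pr (x : L) : Ltilde := (\pi_Ltilde x)%qT.

(* The class of W_N(b); insubd is the identity on L, to which W_N(b) belongs
   when b closes to a knot. *)
Definition Omega_tilde (b : braid) : Ltilde := pr (insubd 0 (W qq ss N b)).

End Ideal.

Definition Qq := {fraction {poly rat}}.
Definition q1 : Qq := tofrac ('X : {poly rat}).

(* Q[q^+-2] *)
Definition LJones : Type := Qalg [:: q1 ^+ 2; q1 ^- 2].
HB.instance Definition _ := GRing.ComNzRing.on LJones.

Definition Jones (N : nat) (b : braid) : Qq := W q1 (q1 ^+ (N - 1)) N b.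

Section ADO.
Variables (R : realType) (N : nat).

Definition Cs := {fraction {poly R[i]}}.
Definition s1 : Cs := tofrac ('X : {poly R[i]}).

(* e^(pi i / N), as a complex number and as a constant *)
Definition xi : R[i] := Complex (cos (pi / N%:R)) (sin (pi / N%:R)).
Definition xiC : Cs := tofrac (xi%:P).

(* Q(xi_N^2)[s^+-2]; Q(xi_N^2) = Q[xi_N^2] since xi_N is a root of unity *)
Definition LADO : Type := Qalg [:: xiC ^+ 2; s1 ^+ 2; s1 ^- 2].
HB.instance Definition _ := GRing.ComNzRing.on LADO.

(* The q-binomials involved are [m]!/([m-j]! [j]!) with m < N, and
   [1], ..., [N-1] do not vanish at q = xi_N. *)
Definition ADO (b : braid) : Cs := W xiC s1 N b.

End ADO.

(* Main.v *)
(* Both evaluations of L kill the generator phi_N(q^2) (s^2 q^(-2N+2) - 1):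
   s = q^(N-1) kills its second factor, and q = xi_N kills the first since xi_N^2
   is a primitive N-th root of unity.  As the ideal is contained in the principal
   ideal of this generator, both evaluations factor through the quotient.

   The entries of the R-matrices are Laurent polynomials in q and s, because the
   q-binomials obey a Pascal rule wherever [1], ..., [N-1] are invertible; so
   W_N commutes with evaluation.  It lies in L by a parity count.  The
   coefficient of v_k (x) v_l in R^(+-1) (v_i (x) v_j) is even in q and has the
   parity of i + k, hence also of j + l, in s.  Each crossing sits over exactly
   one even position, so this parity is the change of the sum of the indices at
   even positions: it telescopes along a word and cancels on the diagonal.  What
   is left is the normalisation s^((N-1)(w-n)), with n + 1 strands, whose exponent
   is even because the permutation of the braid is a cycle of length n + 1 and
   has the sign (-1)^w. *)
From HB Require Import structures.
Require Import Defs.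
From mathcomp Require Import all_boot all_order all_fingroup all_algebra reals.
From mathcomp Require Import fraction ring_quotient generic_quotient cyclotomic.
From mathcomp Require Import complex boolp classical_sets trigo.
From mathcomp Require Import ring zify.

Set Implicit Arguments.
Unset Strict Implicit.
Unset Printing Implicit Defensive.

Import Order.TTheory GRing.Theory Num.Theory.
Local Open Scope ring_scope.

(** * Quantum integers and binomials *)

Lemma sum_shifted_iota (m j : nat) :
  (\sum_(0 <= k < m) (k + j) = (m * (m - 1))./2 + m * j)%N.
Proof.
by rewrite big_split /= sum_nat_const_nat subn0 triangular_sum bin2 subn1.
Qed.

Section QuantumBinomial.
Variables (F : fieldType) (q : F) (N : nat).
Hypotheses (q_neq0 : q != 0)
  (q_order : forall k, (0 < k < N)%N -> q ^+ (2 * k) != 1).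

Lemma qintE m : qint q m = q ^- m * (q ^+ (2 * m) - 1) / (q - q^-1).
Proof.
rewrite /qint; congr (_ / _); rewrite mulrBr mulr1 mul2n -addnn exprD mulKf //.
by rewrite expf_neq0.
Qed.

Lemma qint_neq0 m : (0 < m < N)%N -> qint q m != 0.
Proof.
move=> mN; rewrite qintE !mulf_neq0 ?invr_neq0 ?expf_neq0 ?subr_eq0 ?q_order //.
(* As 0 < m < N forces N > 1, the order hypothesis at k = 1 gives q^2 != 1, so the denominator q -
   q^-1 is nonzero. *)
have q2_neq1 : q ^+ (2 * 1) != 1 by apply: q_order; lia.
apply: contra q2_neq1 => /eqP qV.
by rewrite muln1 expr2 {2}qV divff.
Qed.

Lemma qint_split m n :
  qint q (m + n) = q ^+ n * qint q m + q ^- m * qint q n.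
Proof.
rewrite /qint !mulrA -mulrDl; congr (_ / _).
by rewrite exprD invfM; ring.
Qed.

Lemma qfactS m : qfact q m.+1 = qint q m.+1 * qfact q m.
Proof. by rewrite /qfact big_nat_recr //= mulrC. Qed.

Lemma qfact0 : qfact q 0 = 1.
Proof. by rewrite /qfact big_nil. Qed.

Lemma qfact_neq0 m : (m < N)%N -> qfact q m != 0.
Proof.
elim: m => [|m IHm] mN; first by rewrite qfact0 oner_neq0.
by rewrite qfactS mulf_neq0 ?qint_neq0 // IHm //; lia.
Qed.

Lemma qbin0 m : (m < N)%N -> qbin q m 0 = 1.
Proof. by move=> mN; rewrite /qbin subn0 qfact0 mulr1 divff ?qfact_neq0. Qed.

Lemma qbinn m : (m < N)%N -> qbin q m m = 1.
Proof. by move=> mN; rewrite /qbin subnn qfact0 mul1r divff ?qfact_neq0. Qed.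

(** Splitting [m+1 + j+1] = q^(j+1) [m+1] + q^-(m+1) [j+1] in the numerator gives the two terms; the
    quantum integers cancelled are all below [N], hence invertible. *)
Lemma qbin_pascal m j : (m.+1 + j.+1 < N)%N ->
  qbin q (m.+1 + j.+1) j.+1 =
    q ^+ j.+1 * qbin q (m + j.+1) j.+1 + q ^- m.+1 * qbin q (m.+1 + j) j.
Proof.
move=> mjN; rewrite /qbin !addnK.
have -> : qfact q (m.+1 + j.+1) = qint q (m.+1 + j.+1) * qfact q (m + j.+1).
  by rewrite addSn qfactS.
rewrite qint_split addSnnS !qfactS.
have m1 : qint q m.+1 != 0 by apply: qint_neq0; lia.
have j1 : qint q j.+1 != 0 by apply: qint_neq0; lia.
have fm : qfact q m != 0 by apply: qfact_neq0; lia.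
have fj : qfact q j != 0 by apply: qfact_neq0; lia.
have qm : q ^+ m.+1 != 0 by rewrite expf_neq0.
by field; rewrite m1 j1 fm fj qm.
Qed.

End QuantumBinomial.

(** * Common lifts of two specialisations, graded by parity in q and s *)

Section CommonLift.
Variables (A : comNzRingType) (F F' : fieldType).
Variables (f : {rmorphism A -> F}) (f' : {rmorphism A -> F'}).
Variables (q s : F) (q' s' : F').
Hypotheses (q_neq0 : q != 0) (s_neq0 : s != 0).
Hypotheses (q'_neq0 : q' != 0) (s'_neq0 : s' != 0).
Variables (a2 a2V b2 b2V : A).
Hypotheses (fa2 : f a2 = q ^+ 2) (fa2V : f a2V = q ^- 2).
Hypotheses (fb2 : f b2 = s ^+ 2) (fb2V : f b2V = s ^- 2).
Hypotheses (f'a2 : f' a2 = q' ^+ 2) (f'a2V : f' a2V = q' ^- 2).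
Hypotheses (f'b2 : f' b2 = s' ^+ 2) (f'b2V : f' b2V = s' ^- 2).

(* With [A] the ring of Laurent polynomials in [q^2] and [s^2], the pair [(x, y)]
   consists of two specialisations of one element of [q^a s^b A]. *)
Definition colift (a b : bool) (x : F) (y : F') : Prop :=
  exists2 z : A, f z = x * q ^+ a * s ^+ b & f' z = y * q' ^+ a * s' ^+ b.

Lemma colift_cast a b c d x y :
  a = c -> b = d -> colift a b x y -> colift c d x y.
Proof. by move=> -> ->. Qed.

Lemma colift0 a b : colift a b 0 0.
Proof. by exists 0; rewrite rmorph0 !mul0r. Qed.

Lemma colift1 : colift false false 1 1.
Proof. by exists 1; rewrite rmorph1 !mulr1. Qed.

Lemma coliftD a b x y u v :
  colift a b x y -> colift a b u v -> colift a b (x + u) (y + v).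
Proof.
move=> [z zx zy] [w wu wv].
by exists (z + w); rewrite rmorphD /= ?zx ?zy ?wu ?wv !mulrDl.
Qed.

Lemma coliftN a b x y : colift a b x y -> colift a b (- x) (- y).
Proof.
by move=> [z zx zy]; exists (- z); rewrite rmorphN /= ?zx ?zy !mulNr.
Qed.

Lemma coliftB a b x y u v :
  colift a b x y -> colift a b u v -> colift a b (x - u) (y - v).
Proof. by move=> xy /coliftN; apply: coliftD. Qed.

Lemma coliftM a b c d x y u v :
  colift a b x y -> colift c d u v ->
  colift (a (+) c) (b (+) d) (x * u) (y * v).
Proof.
move=> [z zx zy] [w wu wv].
(* Two odd parities leave a surplus q^2 or s^2 in the product, which [a2V] or [b2V] removes. *)
exists (z * w * a2V ^+ (a && c) * b2V ^+ (b && d));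
  rewrite !rmorphM !rmorphXn /=.
- rewrite zx wu fa2V fb2V; case: a c b d {z w zx zy wu wv} => [] [] [] [] /=;
    rewrite ?expr0 ?expr1; field; by rewrite ?q_neq0 ?s_neq0.
- rewrite zy wv f'a2V f'b2V; case: a c b d {z w zx zy wu wv} => [] [] [] [] /=;
    rewrite ?expr0 ?expr1; field; by rewrite ?q'_neq0 ?s'_neq0.
Qed.

Lemma colift_sum (I : Type) (r : seq I) (P : pred I) a b E E' :
  (forall i, P i -> colift a b (E i) (E' i)) ->
  colift a b (\sum_(i <- r | P i) E i) (\sum_(i <- r | P i) E' i).
Proof.
move=> EE'; elim/big_rec2: _ => [|i u v Pi]; first exact: colift0.
exact/coliftD/EE'.
Qed.

Lemma colift_prod (I : Type) (r : seq I) (d e : I -> nat) E E' :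
  (forall i, colift (odd (d i)) (odd (e i)) (E i) (E' i)) ->
  colift (odd (\sum_(i <- r) d i)) (odd (\sum_(i <- r) e i))
    (\prod_(i <- r) E i) (\prod_(i <- r) E' i).
Proof.
move=> EE'; elim: r => [|i r IHr]; first by rewrite !big_nil; exact: colift1.
by rewrite !big_cons !oddD; apply: coliftM.
Qed.

Lemma coliftX (d e : bool) n x y : colift d e x y ->
  colift (d && odd n) (e && odd n) (x ^+ n) (y ^+ n).
Proof.
move=> xy; elim: n => [|n IHn]; first by rewrite !expr0 !andbF; exact: colift1.
have -> : d && odd n.+1 = d (+) (d && odd n) by case: d {xy IHn} => //=.
have -> : e && odd n.+1 = e (+) (e && odd n) by case: e {xy IHn} => //=.
by rewrite !exprS; apply: coliftM.
Qed.

Lemma colift_q : colift true false q q'.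
Proof. by exists a2; rewrite ?fa2 ?f'a2 expr0 mulr1. Qed.

Lemma colift_qV : colift true false q^-1 q'^-1.
Proof. by exists 1; rewrite rmorph1 expr0 expr1 mulr1 mulVf. Qed.

Lemma colift_s : colift false true s s'.
Proof. by exists b2; rewrite ?fb2 ?f'b2 expr0 mulr1. Qed.

Lemma colift_sV : colift false true s^-1 s'^-1.
Proof. by exists 1; rewrite rmorph1 expr0 expr1 mulr1 mulVf. Qed.

Lemma colift_qX n : colift (odd n) false (q ^+ n) (q' ^+ n).
Proof. exact: coliftX colift_q. Qed.

Lemma colift_qXV n : colift (odd n) false (q ^- n) (q' ^- n).
Proof. by rewrite -!exprVn; exact: coliftX colift_qV. Qed.

Lemma colift_sX n : colift false (odd n) (s ^+ n) (s' ^+ n).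
Proof. exact: coliftX colift_s. Qed.

Lemma colift_sXV n : colift false (odd n) (s ^- n) (s' ^- n).
Proof. by rewrite -!exprVn; exact: coliftX colift_sV. Qed.

Lemma colift_qXz (n : int) : colift (odd `|n|) false (q ^ n) (q' ^ n).
Proof. by case: n => n; [apply: colift_qX | apply: colift_qXV]. Qed.

Lemma colift_sXz (n : int) : colift false (odd `|n|) (s ^ n) (s' ^ n).
Proof. by case: n => n; [apply: colift_sX | apply: colift_sXV]. Qed.

(** * Common lifts of the R-matrices, the braid operators and W_N *)

Variable N : nat.
Hypothesis q_order : forall k, (0 < k < N)%N -> q ^+ (2 * k) != 1.
Hypothesis q'_order : forall k, (0 < k < N)%N -> q' ^+ (2 * k) != 1.

(** The quotient of factorials cannot be lifted directly, since [A] need not allow the divisions;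
    double induction along the Pascal rule uses only sums and products. The parity is that of mj,
    the top q-degree of the balanced binomial. *)
Lemma colift_qbin m j : (m + j < N)%N ->
  colift (odd (m * j)) false (qbin q (m + j) j) (qbin q' (m + j) j).
Proof.
elim: m j => [|m IHm] j.
  rewrite mul0n add0n => jN; rewrite !(qbinn (N := N)) //; exact: colift1.
elim: j => [|j IHj] mjN.
  rewrite muln0 addn0 in mjN *; rewrite !(qbin0 (N := N)) //; exact: colift1.
rewrite (qbin_pascal q_neq0 q_order) // (qbin_pascal q'_neq0 q'_order) //.
apply: coliftD.
- have -> : odd (m.+1 * j.+1) = odd j.+1 (+) odd (m * j.+1) by lia.
  by apply: (coliftM (colift_qX _)); apply: IHm; lia.
- have -> : odd (m.+1 * j.+1) = odd m.+1 (+) odd (m.+1 * j) by lia.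
  by apply: (coliftM (colift_qXV _)); apply: IHj; lia.
Qed.

Lemma colift_s_prod m j :
  colift (odd ((m * (m - 1))./2 + m * j)) (odd m)
    (\prod_(0 <= k < m) (s * q ^- (k + j) - s^-1 * q ^+ (k + j)))
    (\prod_(0 <= k < m) (s' * q' ^- (k + j) - s'^-1 * q' ^+ (k + j))).
Proof.
(* Factor k has q-parity k + j and s-parity 1; summing over k < m gives the two parities claimed. *)
rewrite -sum_shifted_iota -{2}[m](subn0) -[(m - 0)%N]muln1 -sum_nat_const_nat.
apply: colift_prod => k; apply: coliftB.
- exact: (coliftM colift_s (colift_qXV _)).
- exact: (coliftM colift_sV (colift_qX _)).
Qed.

(** The q-parity cancels: m(m-1)/2 comes from the explicit power and again from the product, mj from
    the binomial and again from the product. *)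
Lemma colift_R_term i j m : (m + j < N)%N -> (m <= i)%N ->
  colift false (odd (i + j + m)) (R_term q s i j m) (R_term q' s' i j m).
Proof.
move=> mjN mi.
apply: colift_cast (coliftM (colift_sXV (i + j)) (coliftM (coliftM (coliftM
  (colift_qX (2 * (i - m) * (j + m))) (colift_qX (m * (m - 1))./2))
  (colift_qbin mjN)) (colift_s_prod m j))); rewrite !oddD -?mulnA ?oddM /=.
- by case: (odd _./2) (odd m && odd j) => [] [].
- by [].
Qed.

Lemma colift_Rinv_term i j m : (m + i < N)%N -> (m <= j)%N ->
  colift false (odd (i + j + m)) (Rinv_term q s i j m) (Rinv_term q' s' i j m).
Proof.
move=> miN mj; rewrite /Rinv_term.
have sign : colift false false ((-1) ^+ m) ((-1) ^+ m).
  exact: coliftX (coliftN colift1).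
under eq_bigr do rewrite -[(i + _)%N]addnC.
under [in X in colift _ _ _ X]eq_bigr do rewrite -[(i + _)%N]addnC.
apply: colift_cast (coliftM (colift_sX (i + j)) (coliftM (coliftM (coliftM
  (coliftM sign (colift_qXV (2 * i * j))) (colift_qXV (m * (m - 1))./2))
  (colift_qbin miN)) (colift_s_prod m i))); rewrite !oddD -?mulnA ?oddM /=.
- by case: (odd _./2) (odd m && odd i) => [] [].
- by [].
Qed.

(** Since k + l = i + j on nonzero terms, the s-parity can be read on either strand; [r] selects the
    strand, as the even position may be the left or the right one. The bounds on k and l encode the
    truncation to U and keep the binomials in the range of the Pascal rule. *)
Lemma colift_R_coef e (r : bool) i j k l : (k < N)%N -> (l < N)%N ->
  colift false (odd (if r then j + l else i + k))
    (R_coef q s e i j k l) (R_coef q' s' e i j k l).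
Proof.
move=> kN lN; case: e; apply: colift_sum => m /andP[/eqP kE /eqP lE].
- have -> : odd (if r then j + l else i + k) = odd (i + j + m).
    by case: m kE lE => m /=; case: r; lia.
  by apply: colift_R_term; case: m kE {lE} => m /=; lia.
- have -> : odd (if r then j + l else i + k) = odd (i + j + m).
    by case: m kE lE => m /=; case: r; lia.
  by apply: colift_Rinv_term; case: m lE {kE} => m /=; lia.
Qed.

Definition height n (a : state N n) : bool :=
  \big[addb/false]_(p < n.+1 | ~~ odd p) odd (a p).

Lemma height_crossing n (i : 'I_n) (a c : state N n) :
  [forall k, (k != lpos i) && (k != rpos i) ==> (c k == a k)] ->
  height c = height a (+)
    odd (if odd i then a (rpos i) + c (rpos i) else a (lpos i) + c (lpos i))%N.
Proof.
(* [p] is the even one of the positions i and i + 1, counted from 0; the other does not enter the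
   height. *)
move=> /forallP ca; pose p := if odd i then rpos i else lpos i.
have -> : (if odd i then a (rpos i) + c (rpos i) else a (lpos i) + c (lpos i))%N
    = (a p + c p)%N by rewrite /p; case: (odd i).
apply: (canRL (addKb _)); rewrite -big_split /= oddD.
have p_even : ~~ odd p by rewrite /p; case: ifP => //= ->.
rewrite (bigD1 p) //= big1 ?addbF // => k /andP[k_even kp].
have /implyP/(_ _)/eqP -> := ca k; first by rewrite addbb.
move: kp; rewrite /p; case: ifP => i_odd kp; rewrite kp ?andbT /=;
  by apply: contraNneq k_even => ->; rewrite /= i_odd.
Qed.

(** Here [d] plays the height of the initial basis vector, carried unchanged through the word; the
    s-parity of a crossing is the change of height. *)
Lemma colift_gen_op n (g : 'I_n * bool) d (x : Upow F N n) (y : Upow F' N n) :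
  (forall c, colift false (height c (+) d) (x c) (y c)) ->
  forall c, colift false (height c (+) d)
    (gen_op q s g x c) (gen_op q' s' g y c).
Proof.
case: g => i e xy c; rewrite !ffunE; apply: colift_sum => a ca.
rewrite (height_crossing ca) addbAC addbC.
exact: (coliftM (colift_R_coef _ _ _ _ (ltn_ord _) (ltn_ord _)) (xy a)).
Qed.

Lemma colift_rho n (w : seq ('I_n * bool)) (a c : state N n) :
  colift false (height c (+) height a)
    (rho q s w (basis F a) c) (rho q' s' w (basis F' a) c).
Proof.
elim: w c => [|g w IHw] c /=; last exact: colift_gen_op.
rewrite !ffunE; case: eqP => [->|_]; last exact: colift0.
by rewrite addbb; exact: colift1.
Qed.

Lemma colift_W (b : braid) : odd `|writhe b| = odd (nb b) ->
  colift false false (W q s N b) (W q' s' N b).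
Proof.
move=> w_nb; apply: (@colift_cast (false (+) false) (false (+) false)) => //.
apply: coliftM.
- apply: colift_cast (coliftM (coliftM (colift_sXz _) (colift_qXz _))
    (coliftM (colift_sXV _) (colift_qX _))).
  (* For q, N(N - 1) is even; for s, next, w(N - 1) and (N - 1)n have the same parity by
     hypothesis. *)
  + by rewrite abszN abszM !oddM /=; case: N => [|[|m]] //=; lia.
  + by rewrite abszM !oddM /= w_nb !addbF andbC addbb.
- apply: colift_sum => a _.
  have := coliftM (colift_qXV (2 * \sum_(k < nb b) a (lift ord0 k)))
    (colift_rho (word b) a a).
  by rewrite addbb oddM.
Qed.

Lemma W_common_lift (b : braid) : odd `|writhe b| = odd (nb b) ->
  exists2 z : A, f z = W q s N b & f' z = W q' s' N b.
Proof. by move=> /colift_W[z]; rewrite !expr0 !mulr1; exists z. Qed.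

End CommonLift.

(** * Parity of the writhe of a knot closure *)

Lemma odd_braid_perm (b : braid) : odd_perm (braid_perm b) = odd `|writhe b|.
Proof.
rewrite /braid_perm /writhe; elim: (word b) => [|g w IHw].
  by rewrite !big_nil odd_perm1.
(* Each letter is a transposition and changes the writhe by 1 or -1, so it flips both parities. *)
rewrite !big_cons odd_mul_tperm IHw.
have -> : lpos g.1 != rpos g.1 by rewrite -val_eqE /= /bump; lia.
move: (\sum_(_ <- _) _ : int) => z.
by case: g.2; lia.
Qed.

Lemma knot_writhe_parity (b : braid) : closes_to_knot b ->
  odd `|writhe b| = odd (nb b).
Proof.
move=> knot; rewrite -odd_braid_perm /odd_perm knot card_ord /=.
by rewrite addbT negbK.
Qed.

(** * Morphisms out of quotients and into generated subrings *)

Lemma ideal_quot_lift (A B : comNzRingType) (I : idealr A)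
    (f : {rmorphism A -> B}) :
  (forall x, x \in I -> f x = 0) ->
  exists g : {rmorphism {ideal_quot I} -> B},
    forall x, g (\pi_({ideal_quot I})%qT x) = f x.
Proof.
move=> fI; pose g (x : {ideal_quot I}) := f (repr x).
have gpi x : g (\pi_({ideal_quot I})%qT x) = f x.
  apply/eqP; rewrite -subr_eq0 -rmorphB; apply/eqP/fI.
  by rewrite Quotient.idealrBE reprK.
have gB : zmod_morphism g.
  move=> x y; rewrite -[x]reprK -[y]reprK.
  by rewrite -(rmorphB (\pi_({ideal_quot I})%qT)) !gpi rmorphB.
have gM : monoid_morphism g.
  split; first by rewrite -(rmorph1 (\pi_({ideal_quot I})%qT)) gpi rmorph1.
  move=> x y; rewrite -[x]reprK -[y]reprK.
  by rewrite -(rmorphM (\pi_({ideal_quot I})%qT)) !gpi rmorphM.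
pose gBm := GRing.isZmodMorphism.Build _ _ g gB.
pose gMm := GRing.isMonoidMorphism.Build _ _ g gM.
pose h : {rmorphism _ -> _} := HB.pack g gBm gMm.
by exists h.
Qed.

(** The morphism [i] forces characteristic 0, so the denominator of c can be cleared in F. *)
Lemma ratr_denq (F : fieldType) (i : {rmorphism rat -> F}) c :
  ratr c * (denq c)%:~R = (numq c)%:~R :> F.
Proof.
by rewrite -(fmorph_eq_rat i) -!(rmorph_int i) -rmorphM -numqE.
Qed.

(** [Qadj xs] is the smallest subring containing the rationals and xs, so it lies in the subring of
    elements whose image is in [Qadj ys] as soon as the generators do. *)
Lemma Qalg_corestrict (F F' : fieldType) (xs : seq F) (ys : seq F')
    (i : {rmorphism rat -> F}) (i' : {rmorphism rat -> F'})
    (f : {rmorphism Qalg xs -> F'}) :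
  (forall x, val x \in xs -> f x \in Qadj ys) ->
  exists g : {rmorphism Qalg xs -> Qalg ys}, forall x, val (g x) = f x.
Proof.
move=> f_xs.
have f_rat x c : val x = ratr c -> f x = ratr c.
  move=> xc; have den_neq0 : (denq c)%:~R != 0 :> F'.
    by rewrite -(rmorph_int i') fmorph_eq0 intr_eq0 denq_neq0.
  apply: (mulIf den_neq0); rewrite (ratr_denq i') -(rmorph_int f) -rmorphM.
  rewrite -(rmorph_int f (numq c)); congr (f _); apply: val_inj.
  by rewrite rmorphM !rmorph_int /= xc (ratr_denq i).
have f_mem x : f x \in Qadj ys.
  pose P : {pred F} :=
    fun u => `[< exists2 x : Qalg xs, val x = u & f x \in Qadj ys >].
  suff /asboolP[z /val_inj <- //] : val x \in P.
  have /asboolP xP := QvalP x; apply: xP.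
  - split.
    + by apply/asboolP; exists 1; rewrite ?rmorph1 // rpred1.
    + move=> u v /asboolP[y <- fy] /asboolP[z <- fz]; apply/asboolP.
      by exists (y - z); rewrite rmorphB // rpredB.
    + move=> u v /asboolP[y <- fy] /asboolP[z <- fz]; apply/asboolP.
      by exists (y * z); rewrite rmorphM // rpredM.
  - move=> c; have c_mem (E : fieldType) (zs : seq E) : ratr c \in Qadj zs.
      by apply/asboolP => Q _ Qrat _; apply: Qrat.
    apply/asboolP; exists (MkQalg (c_mem F xs)); first by [].
    by rewrite (f_rat _ c) ?c_mem.
  - move=> u uxs; apply/asboolP.
    by exists (MkQalg (mem_Qadj uxs)); rewrite ?f_xs.
pose g x : Qalg ys := MkQalg (f_mem x).
have gB : zmod_morphism g.
  by move=> x y; apply: val_inj; rewrite [RHS]rmorphB /= rmorphB.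
have gM : monoid_morphism g.
  split=> [|x y]; apply: val_inj; first by rewrite [RHS]rmorph1 /= rmorph1.
  by rewrite [RHS]rmorphM /= rmorphM.
pose gBm := GRing.isZmodMorphism.Build _ _ g gB.
pose gMm := GRing.isMonoidMorphism.Build _ _ g gM.
pose h : {rmorphism _ -> _} := HB.pack g gBm gMm.
by exists h.
Qed.

(** * Evaluations of L *)

Lemma s2V_mem : ss ^- 2 \in Qadj [:: qq ^+ 2; qq ^- 2; ss ^+ 2; ss ^- 2].
Proof. exact: mem_Qadj (mem_last (qq ^+ 2) [:: qq ^- 2; ss ^+ 2; ss ^- 2]). Qed.
Definition s2V : L := MkQalg s2V_mem.

(** An element of L is p / (qs)^k for a polynomial p, and its value is ev p / ev(qs)^k.
    Cross-multiplication shows that this does not depend on the choice of k and p. *)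
Lemma L_eval (F : fieldType) (ev : {rmorphism {poly {poly rat}} -> F}) :
  ev 'X%:P != 0 -> ev 'X != 0 ->
  exists g : {rmorphism L -> F},
    [/\ g q2 = ev 'X%:P ^+ 2, g q2V = ev 'X%:P ^- 2,
        g s2 = ev 'X ^+ 2 & g s2V = ev 'X ^- 2].
Proof.
move=> evq evs; set qs : {poly {poly rat}} := 'X%:P * 'X.
have evqs k : ev qs ^+ k != 0 by rewrite expf_neq0 // rmorphM mulf_neq0.
have L_qs (x : L) : exists k p, val x * tofrac qs ^+ k = tofrac p := L_poly x.
clearbody qs.
(* Quantifying over all presentations builds well-definedness into the choice of [g]. *)
have /choice[g gE] (x : L) : exists y, forall k p,
    val x * tofrac qs ^+ k = tofrac p -> y * ev qs ^+ k = ev p.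
  have [l [r xr]] := L_qs x; exists (ev r / ev qs ^+ l) => k p xp.
  rewrite mulrAC; apply: (canLR (mulfK (evqs l))).
  rewrite -!rmorphXn -!rmorphM; congr (ev _).
  apply/eqP; rewrite -tofrac_eq !rmorphM !rmorphXn /= -xr -xp.
  by rewrite mulrAC.
have g_poly x p : val x = tofrac p -> g x = ev p.
  by move=> xp; have := gE x 0%N p; rewrite !expr0 !mulr1; exact.
have valB (x y : L) : val (x - y) = val x - val y by rewrite rmorphB.
have valM (x y : L) : val (x * y) = val x * val y by rewrite rmorphM.
have gB : zmod_morphism g.
  move=> x y; have [k [p xp]] := L_qs x; have [l [r yr]] := L_qs y.
  apply: (mulIf (evqs (k + l)%N)); rewrite (gE _ _ (p * qs ^+ l - r * qs ^+ k)).
    rewrite rmorphB !rmorphM !rmorphXn /= -(gE _ _ _ xp) -(gE _ _ _ yr) exprD.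
    ring.
  rewrite valB [tofrac (_ - _)]rmorphB !rmorphM !rmorphXn /= -xp -yr exprD /=.
  ring.
have gM : monoid_morphism g.
  split.
    by rewrite (g_poly _ 1) ?rmorph1.
  move=> x y; have [k [p xp]] := L_qs x; have [l [r yr]] := L_qs y.
  apply: (mulIf (evqs (k + l)%N)); rewrite (gE _ _ (p * r)).
    rewrite rmorphM -(gE _ _ _ xp) -(gE _ _ _ yr) exprD; ring.
  rewrite valM [tofrac (p * r)]rmorphM /= -xp -yr exprD /=.
  ring.
pose gBm := GRing.isZmodMorphism.Build _ _ g gB.
pose gMm := GRing.isMonoidMorphism.Build _ _ g gM.
have gq2 : g q2 = ev 'X%:P ^+ 2.
  by rewrite (g_poly _ ('X%:P ^+ 2)) rmorphXn.
have gs2 : g s2 = ev 'X ^+ 2.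
  by rewrite (g_poly _ ('X ^+ 2)) rmorphXn.
have inv (x y : L) : val x * val y = 1 -> g y = (g x)^-1.
  move=> xy; have gxy : g x * g y = 1.
    by rewrite -gM.2 -gM.1; congr g; apply: val_inj; rewrite rmorphM.
  exact/esym/mulr1_eq.
pose h : {rmorphism _ -> _} := HB.pack g gBm gMm.
exists h; split=> //=.
- rewrite (inv q2) ?gq2 //= mulfV // expf_neq0 //; exact: qq_neq0.
- rewrite (inv s2) ?gs2 //= mulfV // expf_neq0 //; exact: ss_neq0.
Qed.

Lemma L_specialisation (F : fieldType) (i : {rmorphism rat -> F}) (x y : F) :
  x != 0 -> y != 0 ->
  exists g : {rmorphism L -> F},
    [/\ g q2 = x ^+ 2, g q2V = x ^- 2, g s2 = y ^+ 2 & g s2V = y ^- 2].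
Proof.
move=> x_neq0 y_neq0.
(* The inner variable is q and the outer one is s: coefficients are evaluated at x, then the result
   at y. *)
have i_x : commr_rmorph i x by move=> c; apply: mulrC.
have ix_y : commr_rmorph (horner_morph i_x) y by move=> c; apply: mulrC.
have [||g gE] := L_eval (ev := horner_morph ix_y).
- by rewrite /= horner_morphC /= horner_morphX.
- by rewrite /= horner_morphX.
by exists g; move: gE; rewrite /= !horner_morphC /= !horner_morphX.
Qed.

(** * Specialising W_N on L and on the quotient *)

Lemma expX_neq1 (A : idomainType) k : (0 < k)%N -> ('X : {poly A}) ^+ k != 1.
Proof.
move=> k_gt0; apply/eqP => /(congr1 (fun p : {poly A} => size p)) /eqP.
by rewrite size_polyXn size_poly1 eqSS; case: k k_gt0.
Qed.

Lemma qq_order k : (0 < k)%N -> qq ^+ k != 1.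
Proof.
move=> k_gt0; rewrite /qq -rmorphXn -(rmorph1 (@tofrac _)) tofrac_eq.
by rewrite -polyC_exp -polyC1 (inj_eq (@polyC_inj _)) expX_neq1.
Qed.

Lemma q1_order k : (0 < k)%N -> q1 ^+ k != 1.
Proof.
move=> k_gt0; rewrite /q1 -rmorphXn -(rmorph1 (@tofrac _)) tofrac_eq.
exact: expX_neq1.
Qed.

(** W_N over Q(q,s) is built from quotients outside L, where [g] is undefined. A common lift along
    the inclusion [val] and along [g] yields one element of L with both values. *)
Lemma W_specialisation (F : fieldType) (g : {rmorphism L -> F}) (x y : F)
    (N : nat) (b : braid) :
  x != 0 -> y != 0 -> g q2 = x ^+ 2 -> g q2V = x ^- 2 ->
  g s2 = y ^+ 2 -> g s2V = y ^- 2 ->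
  (forall k, (0 < k < N)%N -> x ^+ (2 * k) != 1) -> closes_to_knot b ->
  exists2 z : L, val z = W qq ss N b & g z = W x y N b.
Proof.
move=> x_neq0 y_neq0 gq2 gq2V gs2 gs2V x_order knot.
apply: (@W_common_lift L Qqs F val g _ _ _ _ qq_neq0 ss_neq0 x_neq0 y_neq0
  q2 q2V s2 s2V) => //; last exact: knot_writhe_parity.
by move=> k /andP[k_gt0 _]; apply: qq_order; rewrite muln_gt0.
Qed.

Lemma mem_seq4_cases (T : eqType) (a b c d x : T) :
  x \in [:: a; b; c; d] -> [\/ x = a, x = b, x = c | x = d].
Proof.
rewrite !inE.
by case/or4P=> /eqP; [apply: Or41 | apply: Or42 | apply: Or43 | apply: Or44].
Qed.

(** Serves both halves of the theorem, with (x, y) equal to (q, q^(N-1)) or to (xi_N, s). The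
    equation on the cyclotomic value says that the evaluation kills [gen_top]. *)
Lemma Ltilde_specialisation (F : fieldType) (i : {rmorphism rat -> F})
    (x y : F) (ys : seq F) (N : nat) (b : braid) :
  x != 0 -> y != 0 ->
  x ^+ 2 \in Qadj ys -> x ^- 2 \in Qadj ys ->
  y ^+ 2 \in Qadj ys -> y ^- 2 \in Qadj ys ->
  (map_poly intr 'Phi_N).[x ^+ 2] * (y ^+ 2 * x ^- 2 ^+ (N - 1) - 1) = 0 ->
  (forall k, (0 < k < N)%N -> x ^+ (2 * k) != 1) -> closes_to_knot b ->
  exists f : {rmorphism Ltilde N -> Qalg ys},
    [/\ val (f (pr N q2)) = x ^+ 2, val (f (pr N s2)) = y ^+ 2
      & val (f (Omega_tilde N b)) = W x y N b].
Proof.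
move=> x_neq0 y_neq0 x2 x2V y2 y2V top0 x_order knot.
have [g [gq2 gq2V gs2 gs2V]] := L_specialisation i x_neq0 y_neq0.
pose i0 : {rmorphism rat -> Qqs} :=
  @tofrac {poly {poly rat}} \o (polyC \o polyC).
have [|h hg] := Qalg_corestrict i0 i (f := g) (ys := ys).
  move=> z /mem_seq4_cases[] zE.
  - by rewrite (_ : z = q2) ?gq2 //; apply: val_inj.
  - by rewrite (_ : z = q2V) ?gq2V //; apply: val_inj.
  - by rewrite (_ : z = s2) ?gs2 //; apply: val_inj.
  - by rewrite (_ : z = s2V) ?gs2V //; apply: val_inj.
have g_top : g (gen_top N) = 0.
  rewrite /gen_top rmorphM rmorphB rmorph1 rmorphM rmorphXn /= gs2 gq2V.
  by rewrite /phi -horner_map -map_poly_comp gq2 (eq_map_poly (rmorph_int g)).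
have [|f fh] := @ideal_quot_lift _ _ (Itilde N) h.
  move=> z /asboolP[[r rG ->] _]; apply: val_inj; rewrite hg rmorph0 rmorph_sum.
  by rewrite big_seq big1 //= => u /rG ->; rewrite rmorphM g_top mulr0.
have [z zW gW] :=
  W_specialisation x_neq0 y_neq0 gq2 gq2V gs2 gs2V x_order knot.
exists f; split; rewrite /Omega_tilde /pr fh hg //.
(* W_N is the value of z in L, so [insubd] returns z and not its default 0. *)
by rewrite -zW valKd.
Qed.

(** * Cyclotomic polynomials and the root of unity xi_N *)

Lemma Cyclotomic_root (F : fieldType) n (z : F) : (0 < n)%N -> z ^+ n = 1 ->
  (forall k, (0 < k < n)%N -> z ^+ k != 1) -> (map_poly intr 'Phi_n).[z] = 0.
Proof.
move=> n_gt0 zn z_order.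
have PhiP d : (0 < d)%N -> z ^+ d - 1 =
    \prod_(e <- divisors d) (map_poly intr 'Phi_e).[z].
  move=> d_gt0; rewrite -horner_prod -rmorph_prod prod_Cyclotomic //.
  by rewrite rmorphB rmorph1 /= map_polyXn !hornerE.
(* Some factor of z^n - 1 vanishes, say at the divisor d; then z^d = 1, and the order hypothesis
   leaves only d = n. *)
have /eqP := PhiP n n_gt0; rewrite zn subrr eq_sym prodf_seq_eq0.
case/hasP => d; rewrite -dvdn_divisors // => dn /= /eqP Phi_d.
have d_gt0 : (0 < d)%N by apply: dvdn_gt0 dn.
have /eqP := PhiP d d_gt0; rewrite (big_rem d) /=; last first.
  by rewrite -dvdn_divisors.
rewrite Phi_d mul0r subr_eq0 => zd; case: (ltngtP d n) => [dn'|dn'|<- //].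
  by have := z_order d; rewrite zd d_gt0 dn' => /(_ isT).
by move: dn' (dvdn_leq n_gt0 dn); rewrite ltnNge => /negbTE ->.
Qed.

Section RootOfUnity.
Variables (R : realType) (N : nat).
Hypothesis N_gt1 : (1 < N)%N.

Let N_gt0 : 0 < N%:R :> R. Proof. by rewrite ltr0n ltnW. Qed.

Lemma xiX k : xi R N ^+ k =
  Complex (cos (k%:R * (pi / N%:R))) (sin (k%:R * (pi / N%:R))).
Proof.
elim: k => [|k IHk]; first by rewrite mul0r cos0 sin0.
rewrite exprS IHk -natr1 [(_ + 1) * _]mulrDl mul1r cosD sinD; congr Complex.
  by ring.
by ring.
Qed.

(** If xi^(2k) = 1 then xi^k is 1 or -1, hence real; but its imaginary part sin(k pi / N) is
    positive for 0 < k < N. *)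
Lemma xi_order k : (0 < k < N)%N -> xi R N ^+ (2 * k) != 1.
Proof.
move=> /andP[k_gt0 kN]; rewrite mulnC exprM sqrf_eq1 xiX.
have sin_gt0 : 0 < sin (k%:R * (pi / N%:R) : R).
  apply: sin_gt0_pi; rewrite mulr_gt0 ?ltr0n ?divr_gt0 ?pi_gt0 //=.
  by rewrite mulrCA gtr_pMr ?pi_gt0 // ltr_pdivrMr // mul1r ltr_nat.
by apply/negP => /orP[] /eqP[_ /eqP]; rewrite ?oppr0 gt_eqF.
Qed.

Lemma xi_unity : xi R N ^+ (2 * N) = 1.
Proof.
rewrite mulnC exprM xiX mulrCA divff ?gt_eqF // mulr1 cospi sinpi.
apply/eqP; rewrite sqrf_eq1; apply/orP; right; apply/eqP.
by rewrite -[RHS]/(Complex _ _) oppr0.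
Qed.

Lemma xiCX k : xiC R N ^+ k = tofrac (xi R N ^+ k)%:P.
Proof. by rewrite /xiC -rmorphXn -polyC_exp. Qed.

Lemma xiC_order k : (0 < k < N)%N -> xiC R N ^+ (2 * k) != 1.
Proof.
move=> kN; rewrite xiCX -(rmorph1 (@tofrac _)) tofrac_eq.
by rewrite -polyC1 (inj_eq (@polyC_inj _)) xi_order.
Qed.

Lemma xiC_unity : xiC R N ^+ (2 * N) = 1.
Proof. by rewrite xiCX xi_unity polyC1 rmorph1. Qed.

Lemma xiC_Cyclotomic : (map_poly intr 'Phi_N).[xiC R N ^+ 2] = 0.
Proof.
apply: Cyclotomic_root => [||k kN]; rewrite -?exprM; first exact: ltnW.
  exact: xiC_unity.
exact: xiC_order.
Qed.

Lemma xiC_neq0 : xiC R N != 0.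
Proof.
apply/eqP => xi0; have /eqP := xiC_unity.
rewrite xi0 expr0n muln_eq0 /= gtn_eqF ?(ltnW N_gt1) //.
by rewrite eq_sym oner_eq0.
Qed.

End RootOfUnity.

(** * The coloured Jones and ADO specialisations *)

Lemma exprXV2 (F : fieldType) (x : F) n :
  x != 0 -> (x ^+ n) ^+ 2 * x ^- 2 ^+ n = 1.
Proof. by move=> x_neq0; rewrite exprVn exprAC divff // !expf_neq0. Qed.

Theorem corollary5p2 (R : realType) (N : nat) (hN : (2 <= N)%N)
    (K : oriented_knot) (b : braid) (hb : closure_of K b) :
  [/\ W qq ss N b \in L_pred,
      exists f : {rmorphism Ltilde N -> LJones},
        [/\ val (f (pr N q2)) = q1 ^+ 2,
            val (f (pr N s2)) = q1 ^+ (2 * (N - 1))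
          & val (f (Omega_tilde N b)) = Jones N b]
    & exists g : {rmorphism Ltilde N -> LADO R N},
        [/\ val (g (pr N q2)) = xiC R N ^+ 2,
            val (g (pr N s2)) = s1 R ^+ 2
          & val (g (Omega_tilde N b)) = ADO R N b]].
Proof.
have knot := closure_of_knot hb.
have q1_neq0 : q1 != 0 by rewrite tofrac_eq0 polyX_eq0.
have s1_neq0 : s1 R != 0 by rewrite tofrac_eq0 polyX_eq0.
split.
(* Taking the inclusion of L itself as the specialisation gives membership in L. *)
- have [|z <- _] := @W_specialisation _ val _ _ N b qq_neq0 ss_neq0
    erefl erefl erefl erefl _ knot; last exact: QvalP.
  by move=> k /andP[k_gt0 _]; apply: qq_order; rewrite muln_gt0.
- pose i : {rmorphism rat -> Qq} := @tofrac {poly rat} \o polyC.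
  have q2_mem : q1 ^+ 2 \in Qadj [:: q1 ^+ 2; q1 ^- 2].
    exact: mem_Qadj (mem_head _ _).
  have q2V_mem : q1 ^- 2 \in Qadj [:: q1 ^+ 2; q1 ^- 2].
    exact: mem_Qadj (mem_last _ [:: _]).
  have [|||||f [fq fs fW]] := @Ltilde_specialisation Qq i q1 (q1 ^+ (N - 1))
    [:: q1 ^+ 2; q1 ^- 2] N b q1_neq0 _ q2_mem q2V_mem _ _ _ _ knot.
  + by rewrite expf_neq0.
  + by rewrite exprAC rpredX.
  + by rewrite exprAC -exprVn rpredX.
  + by rewrite exprXV2 // subrr mulr0.
  + by move=> k /andP[k_gt0 _]; apply: q1_order; rewrite muln_gt0.
  by exists f; rewrite fq fs fW exprM exprAC.
- pose i : {rmorphism rat -> Cs R} := @tofrac {poly R[i]} \o (polyC \o ratr).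
  pose ys := [:: xiC R N ^+ 2; s1 R ^+ 2; s1 R ^- 2].
  have x2_mem : xiC R N ^+ 2 \in Qadj ys by exact: mem_Qadj (mem_head _ _).
  (* Only xi^2 is adjoined, so its inverse is obtained as a power of it, from xi^(2N) = 1. *)
  have x2V : xiC R N ^- 2 = (xiC R N ^+ 2) ^+ (N - 1).
    apply: mulr1_eq; rewrite -exprS -exprM -[RHS](xiC_unity R hN).
    by congr (_ ^+ (_ * _)); lia.
  have [||||f [fq fs fW]] := @Ltilde_specialisation (Cs R) i (xiC R N) (s1 R)
    ys N b (xiC_neq0 R hN) s1_neq0 x2_mem _ _ _ _ (xiC_order R hN) knot.
  + by rewrite x2V rpredX.
  + by apply: mem_Qadj; rewrite in_cons mem_head orbT.
  + exact: mem_Qadj (mem_last _ [:: _; _]).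
  + by rewrite (xiC_Cyclotomic R hN) mul0r.
  by exists f; rewrite fq fs fW.
Qed.
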